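(* For $(A,B)\in\mathbb{R}^2$ let $$H^{(4)}(A,B)=\begin{pmatrix} -iA&-1&0&0\\ -1&-iB&-1&0\\ 0&-1&iB&-1\\ 0&0&-1&iA\end{pmatrix}.$$ Let $\mathcal{D}\subset\mathbb{R}^2$ be the set of all $(A,B)\in\mathbb{R}^2$ for which all four eigenvalues of $H^{(4)}(A,B)$ are real and pairwise distinct. Then $\mathcal{D}$ is non-empty, there exist pairs $(A^{(EP4)},B^{(EP4)})\in\mathbb{R}^2$ that are exceptional points of order four (EP4) of $H^{(4)}$, and these pairs lie on the boundary of $\mathcal{D}$ in $\mathbb{R}^2$.
   Context: A pair $(A,B)\in\mathbb{R}^2$ is called an exceptional point of order four (EP4) of $H^{(4)}$ if there exists an invertible matrix $Q\in\mathbb{C}^{4\times4}$ such that $Q^{-1}H^{(4)}(A,B)\,Q=J^{(4)}$, where $J^{(4)}$ is the $4\times4$ nilpotent Jordan block (zeros on the diagonal, ones on the first superdiagonal, zeros elsewhere). Thus, at an EP4, all four eigenvalues merge at $E=0$ and $H^{(4)}$ has a single eigenvector up to scaling. The set $\mathcal{D}$ is called the physical domain, or the domain of unbroken $\mathcal{PT}$-symmetry. *)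

(* Defs.v *)
From HB Require Import structures.
From mathcomp Require Import all_boot all_order all_algebra.
From mathcomp Require Import all_classical all_reals all_analysis.
From mathcomp Require Import complex.

Set Implicit Arguments.
Unset Strict Implicit.
Unset Printing Implicit Defensive.

Import Order.TTheory GRing.Theory Num.Theory.
Import numFieldNormedType.Exports.

Local Open Scope classical_set_scope.
Local Open Scope ring_scope.
Local Open Scope complex_scope.

Definition boundary (T : topologicalType) (S : set T) : set T :=
  closure S `\` interior S.

Definition matrix4 (K : nzRingType) (rows : seq (seq K)) : 'M[K]_4 :=
  \matrix_(i < 4, j < 4) nth 0 (nth [::] rows i) j.

Definition H4 (R : realType) (A B : R) : 'M[R[i]]_4 :=
  let a : R[i] := A%:C in
  let b : R[i] := B%:C in
  matrix4 [:: [:: - ('i%C * a);         -1;      0;      0 ];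
              [::         -1; - ('i%C * b);     -1;      0 ];
              [::          0;         -1; 'i%C * b;     -1 ];
              [::          0;          0;     -1; 'i%C * a ]].

Definition J4 (R : realType) : 'M[R[i]]_4 :=
  \matrix_(i < 4, j < 4) (j == i.+1 :> nat)%:R.

Definition EP4 (R : realType) (p : R * R) : Prop :=
  exists2 Q : 'M[R[i]]_4, Q \in unitmx &
    invmx Q *m H4 p.1 p.2 *m Q = J4 R.

(* A 4 x 4 matrix with four distinct eigenvalues has no further ones, so
   algebraic multiplicities do not enter.  The library predicate [eigenvalue]
   is about row eigenvectors, which have the same eigenvalues as column ones. *)
Definition physical_domain (R : realType) : set (R * R) :=
  [set p | exists E : 'I_4 -> R, injective E /\
     forall z : R[i], eigenvalue (H4 p.1 p.2) z <-> exists i, z = (E i)%:C].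

Arguments physical_domain R : clear implicits.

(* Main.v *)
(* The characteristic polynomial of [H4 A B] is z^4 + b z^2 + c with
   b = A^2 + B^2 - 3 and c = (AB + 1)^2 - A^2.  Hence (A, B) lies in the
   physical domain as soon as b < 0 < c and 4c < b^2, while the matrix, being
   nonderogatory, is similar to [J4] exactly when b = c = 0.
   The curve c = 0 is the union of the hyperbolas B = s - 1/A with s = 1 or -1.
   At a point with b < 0 and c = 0, replacing B by B + st with small t > 0 makes
   c positive.  Along a hyperbola A^2 b is the polynomial
   A^4 - 2A^2 - 2sA + 1, all of whose real roots are simple, so next to each
   point with b = c = 0 there are points with b < 0 and c = 0. *)
Require Import Defs.
From mathcomp Require Import all_boot all_order all_algebra.
From mathcomp Require Import all_classical all_reals all_analysis.
From mathcomp Require Import complex ring lra.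

Set Implicit Arguments.
Unset Strict Implicit.
Unset Printing Implicit Defensive.

Import Order.TTheory GRing.Theory Num.Theory.
Import numFieldNormedType.Exports.

Local Open Scope classical_set_scope.
Local Open Scope ring_scope.
Local Open Scope complex_scope.

(** * General facts on determinants, closures and biquadratic equations *)

Lemma det_matrix4_tridiag (K : comNzRingType) (a b c d u : K) :
  \det (matrix4 [:: [:: a; u; 0; 0]; [:: u; b; u; 0];
                    [:: 0; u; c; u]; [:: 0; 0; u; d]])
  = a * b * c * d - u ^+ 2 * (a * b + a * d + c * d) + u ^+ 4.
Proof.
do 3!rewrite !(expand_det_row _ ord0) !big_ord_recl !big_ord0 /cofactor.
rewrite !det_mx11 /matrix4 !mxE /=.
ring.
Qed.

Lemma horner_char_poly (F : comNzRingType) n (M : 'M[F]_n) z :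
  (char_poly M).[z] = \det (z%:M - M).
Proof.
rewrite -horner_evalE -det_map_mx; congr (\det _); apply/matrixP => i j.
by rewrite !mxE rmorphB rmorphMn /= !horner_evalE hornerX hornerC.
Qed.

Lemma closure_at_right (R : realType) (S : set (R * R)) (f g : R -> R) (a b x : R) :
  f t @[t --> x^'+] --> a -> g t @[t --> x^'+] --> b ->
  (\forall t \near x^'+, S (f t, g t)) -> closure S (a, b).
Proof.
move=> fa gb Sfg U Uab.
have Ufg : \forall t \near x^'+, U (f t, g t) by exact: (cvg_pair fa gb Uab).
have [t [St Ut]] : exists t, S (f t, g t) /\ U (f t, g t).
  by apply: (@filter_ex _ x^'+); exact: filterI.
by exists (f t, g t).
Qed.

(** The squares of [e1] and [e2] are the roots of y^2 + qy + c, which are real, distinct and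
    positive because discriminant, sum and product are positive. *)
Lemma biquadratic_roots (R : rcfType) (q c : R) : q < 0 -> 0 < c -> 4 * c < q ^+ 2 ->
  exists e1 e2, [/\ 0 < e2, e2 < e1, q = - (e1 ^+ 2 + e2 ^+ 2)
                  & c = e1 ^+ 2 * e2 ^+ 2].
Proof.
move=> q0 c0 cq.
pose r := Num.sqrt (q ^+ 2 - 4 * c).
have rr : r ^+ 2 = q ^+ 2 - 4 * c by rewrite sqr_sqrtr; lra.
have r0 : 0 < r by rewrite sqrtr_gt0; lra.
have rq : r < - q by rewrite -(ltr_pXn2r (n := 2)) // ?nnegrE ?sqrrN; lra.
have y1 : 0 < (- q + r) / 2 by lra.
have y2 : 0 < (- q - r) / 2 by lra.
exists (Num.sqrt ((- q + r) / 2)), (Num.sqrt ((- q - r) / 2)).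
by rewrite !sqr_sqrtr ?ltW // sqrtr_gt0 ltr_sqrt //; split; lra.
Qed.

(** * The characteristic polynomial of [H4] *)

Section H4.
Context {R : realType}.
Implicit Types A B : R.

Definition H4_coef2 A B := A ^+ 2 + B ^+ 2 - 3.
Definition H4_coef0 A B := (A * B + 1) ^+ 2 - A ^+ 2.

Lemma det_H4 A B (z : R[i]) :
  \det (z%:M - H4 A B) = z ^+ 4 + (H4_coef2 A B)%:C * z ^+ 2 + (H4_coef0 A B)%:C.
Proof.
transitivity (\det (matrix4
   [:: [:: z + 'i%C * A%:C; 1; 0; 0]; [:: 1; z + 'i%C * B%:C; 1; 0];
       [:: 0; 1; z - 'i%C * B%:C; 1]; [:: 0; 0; 1; z - 'i%C * A%:C]])).
  congr (\det _); apply/matrixP => -[[|[|[|[|//]]]] ?] [[|[|[|[|//]]]] ?];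
    rewrite !mxE /=; ring.
rewrite det_matrix4_tridiag /H4_coef2 /H4_coef0.
rewrite !(rmorphB, rmorphD, rmorphM, rmorphXn, rmorph1, rmorph_nat).
(* The imaginary unit becomes a variable whose square is -1, a relation that [ring] can use. *)
have := sqr_i R; move: ('i%C) => i Hi.
ring: Hi.
Qed.

Lemma eigenvalue_H4 A B (z : R[i]) :
  eigenvalue (H4 A B) z =
  (z ^+ 4 + (H4_coef2 A B)%:C * z ^+ 2 + (H4_coef0 A B)%:C == 0).
Proof. by rewrite eigenvalue_root_char /root horner_char_poly det_H4. Qed.

(** * Similarity to the Jordan block *)

Lemma det_J4 (z : R[i]) : \det (z%:M - J4 R) = z ^+ 4.
Proof.
(* [det_trig] is about lower triangular matrices, hence the transposition. *)
rewrite -det_tr det_trig; last first.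
  apply/is_trig_mxP => i j ij; rewrite !mxE -val_eqE.
  by rewrite /= (gtn_eqF ij) (ltn_eqF (leqW ij)) subr0.
rewrite !big_ord_recl big_ord0 !mxE /=; ring.
Qed.

(** Similar matrices have the same characteristic polynomial, here z^4. Comparing values at 0 and
    then at 1 isolates the two coefficients. *)
Lemma EP4_H4_coef (p : R * R) : EP4 p -> H4_coef2 p.1 p.2 = 0 /\ H4_coef0 p.1 p.2 = 0.
Proof.
case: p => A B /= [Q Qu /= QHJ].
have e z : z ^+ 4 = z ^+ 4 + (H4_coef2 A B)%:C * z ^+ 2 + (H4_coef0 A B)%:C.
  rewrite -det_H4 -det_J4 -QHJ.
  have -> : z%:M - invmx Q *m H4 A B *m Q = invmx Q *m (z%:M - H4 A B) *m Q.
    by rewrite mulmxBr mulmxBl scalar_mxC -(mulmxA z%:M) mulVmx // mulmx1.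
  rewrite !det_mulmx mulrAC -det_mulmx mulVmx // det1; ring.
have c0 : (H4_coef0 A B)%:C = 0 :> R[i].
  by have := e 0; rewrite !expr0n /= mulr0 !add0r => <-.
have q0 : (H4_coef2 A B)%:C = 0 :> R[i].
  have /eqP := e 1; rewrite c0 !expr1n mulr1 addr0.
  by rewrite -subr_eq0 opprD addrA subrr sub0r oppr_eq0 => /eqP.
by case: q0 => ->; case: c0 => ->.
Qed.

(** By Cayley-Hamilton [H4 A B] has fourth power zero, so the iterates of the last basis vector form
    a Jordan chain. They are independent since [Q] is lower triangular with diagonal entries 1 or
    -1. *)
Lemma EP4W A B : H4_coef2 A B = 0 -> H4_coef0 A B = 0 -> EP4 (A, B).
Proof.
move=> q0 c0; rewrite /EP4 /=.
pose a : R[i] := 'i%C * A%:C; pose b : R[i] := 'i%C * B%:C.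
(* [qe] and [ce] recast the two hypotheses as reduction rules for [b ^+ 2] and [a ^+ 4], used by the
   final [ring]. *)
have qe : b ^+ 2 = - 3 - a ^+ 2.
  have : a ^+ 2 + b ^+ 2 + 3 = - (H4_coef2 A B)%:C.
    rewrite /H4_coef2 /a /b !(rmorphB, rmorphD, rmorphXn, rmorph_nat).
    by have := sqr_i R; move: 'i%C => i Hi; ring: Hi.
  rewrite q0 rmorph0 oppr0 => /eqP; rewrite -addrA addrC -addrA addr_eq0.
  by move=> /eqP ->; ring.
have ce : a ^+ 4 = 1 - 2 * (a * b) - 2 * a ^+ 2.
  have : (1 - a * b) ^+ 2 + a ^+ 2 = (H4_coef0 A B)%:C.
    rewrite /H4_coef0 /a /b !(rmorphB, rmorphD, rmorphM, rmorphXn, rmorph1).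
    by have := sqr_i R; move: 'i%C => i Hi; ring: Hi.
  rewrite c0 rmorph0 => e; apply/eqP; rewrite -subr_eq0 -oppr_eq0 -e.
  by apply/eqP; ring: qe.
(* The columns of Q are H^3 e, H^2 e, H e, e for the last basis vector e. *)
pose Q : 'M[R[i]]_4 := matrix4
  [:: [:: -1; 0; 0; 0]; [:: a; 1; 0; 0];
      [:: - 2 - a * b - b ^+ 2 - a ^+ 2; - (a + b); -1; 0];
      [:: b + 2 * a + a ^+ 3; 1 + a ^+ 2; a; 1]].
have Qu : Q \in unitmx.
  rewrite unitmxE det_trig; last first.
    apply/is_trig_mxP; move => -[[|[|[|[|//]]]] ?] [[|[|[|[|//]]]] ?] //=;
    by rewrite !mxE.
  by rewrite !big_ord_recl big_ord0 !mxE /= !unitrM !unitrN unitr1.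
exists Q => //.
suff : H4 A B *m Q = Q *m J4 R by rewrite -mulmxA => ->; rewrite mulKmx.
apply/matrixP => -[[|[|[|[|//]]]] ?] [[|[|[|[|//]]]] ?];
  rewrite !mxE !big_ord_recl !big_ord0 !mxE /= -/a -/b; try ring: qe ce.
Qed.

(** * Membership in the physical domain *)

Lemma physical_domainW A B : H4_coef2 A B < 0 -> 0 < H4_coef0 A B ->
  4 * H4_coef0 A B < H4_coef2 A B ^+ 2 -> physical_domain R (A, B).
Proof.
move=> q0 c0 cq; have [e1 [e2 [e20 e21 qe ce]]] := biquadratic_roots q0 c0 cq.
pose s := [:: e1; - e1; e2; - e2].
exists (fun i : 'I_4 => nth 0 s i); split.
  move=> i j /eqP; rewrite nth_uniq //; first by move/eqP/val_inj.
  rewrite /= !inE !negb_or !andbT.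
  by apply/and3P; split; [apply/and3P; split| apply/andP; split|]; apply/eqP; lra.
move=> z /=; rewrite eigenvalue_H4 qe ce.
have -> : z ^+ 4 + (- (e1 ^+ 2 + e2 ^+ 2))%:C * z ^+ 2 + (e1 ^+ 2 * e2 ^+ 2)%:C =
  \prod_(x <- s) (z - x%:C).
  rewrite !big_cons big_nil !(rmorphN, rmorphD, rmorphM, rmorphXn); ring.
rewrite prodf_seq_eq0; split.
  move=> /hasP [x /(nthP 0) [i i4 <-]]; rewrite /= subr_eq0 => /eqP ->.
  by exists (Ordinal i4).
move=> [i ->]; apply/hasP; exists s`_i; first by rewrite mem_nth.
by rewrite /= subrr.
Qed.

Lemma nilpotent_notin_physical_domain A B : H4_coef2 A B = 0 -> H4_coef0 A B = 0 ->
  ~ physical_domain R (A, B).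
Proof.
move=> q0 c0 [E [injE HE]].
have E0 i : E i = 0.
  have /HE : exists j, (E i)%:C = (E j)%:C by exists i.
  rewrite eigenvalue_H4 /= q0 c0 rmorph0 mul0r !addr0 expf_eq0 /=.
  by rewrite fmorph_eq0 => /eqP.
by have /injE : E ord0 = E ord_max by rewrite !E0.
Qed.

(** * Approximation by points of the physical domain *)

Lemma H4_coef2_cvg (T : Type) (F : set_system T) {FF : Filter F}
    (f g : T -> R) A B :
  f t @[t --> F] --> A -> g t @[t --> F] --> B ->
  H4_coef2 (f t) (g t) @[t --> F] --> H4_coef2 A B.
Proof.
move=> fA gB.
by apply: cvgB; [apply: cvgD; exact: cvgM|exact: cvg_cst].
Qed.

Lemma H4_coef0_cvg (T : Type) (F : set_system T) {FF : Filter F}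
    (f g : T -> R) A B :
  f t @[t --> F] --> A -> g t @[t --> F] --> B ->
  H4_coef0 (f t) (g t) @[t --> F] --> H4_coef0 A B.
Proof.
move=> fA gB.
have fg : f t * g t + 1 @[t --> F] --> A * B + 1.
  by apply: cvgD; [exact: cvgM|exact: cvg_cst].
by apply: cvgB; exact: cvgM.
Qed.

(** A difference of squares vanishes: AB + 1 is A or -A. The sign [s] lets both hyperbolas be
    treated at once. *)
Lemma H4_coef0_eq0 A B : H4_coef0 A B = 0 ->
  exists s, [/\ s ^+ 2 = 1, A != 0 & B = s - A^-1].
Proof.
rewrite /H4_coef0 => /eqP; rewrite subr_eq0 eqf_sqr => c0.
have [s [s2 ABs]] : exists s, s ^+ 2 = 1 /\ A * B + 1 = s * A.
  by case/orP: c0 => /eqP ->; [exists 1|exists (-1)]; split; ring.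
have A0 : A != 0.
  by apply: contra_eq_neq ABs => ->; rewrite mul0r mulr0 add0r oner_eq0.
exists s; split=> //; apply: (mulfI A0).
by rewrite mulrBr divff // (mulrC A s) -ABs addrK.
Qed.

Lemma H4_coef0_hyperbola s A : A != 0 -> s ^+ 2 = 1 -> H4_coef0 A (s - A^-1) = 0.
Proof. by move=> A0 s2; rewrite /H4_coef0; field: s2. Qed.

Lemma closure_physical_domain_coef0 A B : H4_coef2 A B < 0 -> H4_coef0 A B = 0 ->
  closure (physical_domain R) (A, B).
Proof.
move=> q0 c0; have [s [s2 A0 BE]] := H4_coef0_eq0 c0.
pose g t := B + s * t.
have t0 : (t : R) @[t --> 0^'+] --> (0 : R) by apply: cvg_at_right_filter; exact: cvg_id.
have gB : g t @[t --> 0^'+] --> B.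
  rewrite -[X in _ --> X]addr0 -[X in B + X](mulr0 s).
  by apply: cvgD; [exact: cvg_cst|apply: cvgM; [exact: cvg_cst|]].
have fA : A @[t --> (0 : R)^'+] --> A by exact: cvg_cst.
have qg : H4_coef2 A (g t) @[t --> 0^'+] --> H4_coef2 A B by exact: H4_coef2_cvg.
have cg : H4_coef0 A (g t) @[t --> 0^'+] --> H4_coef0 A B by exact: H4_coef0_cvg.
apply: (closure_at_right fA gB).
near=> t; apply: physical_domainW.
- near: t; exact: (cvgr_lt _ qg).
(* Since AB + 1 = sA, the shift turns AB + 1 into sA(1 + t). *)
- have -> : H4_coef0 A (g t) = A ^+ 2 * (t ^+ 2 + 2 * t).
    by rewrite /H4_coef0 /g BE; field: s2.
  rewrite mulr_gt0 ?exprn_even_gt0 //.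
  have : 0 < t by near: t; exact: nbhs_right_gt.
  nra.
(* At t = 0 the difference b^2 - 4c equals b^2 > 0, and it is continuous. *)
- rewrite -subr_gt0; near: t.
  have : H4_coef2 A (g t) * H4_coef2 A (g t) - 4 * H4_coef0 A (g t)
     @[t --> 0^'+] --> H4_coef2 A B * H4_coef2 A B - 4 * H4_coef0 A B.
    by apply: cvgB; apply: cvgM => //; exact: cvg_cst.
  by move=> dg; apply: (cvgr_gt _ dg); rewrite c0; nra.
Unshelve. all: by end_near.
Qed.

(** Moving along the hyperbola against the derivative of [P] makes b negative. The points met there
    have c = 0 and are only known to lie in the closure, so the closure is taken twice. *)
Lemma closure_physical_domain_nilpotent A B : H4_coef2 A B = 0 -> H4_coef0 A B = 0 ->
  closure (physical_domain R) (A, B).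
Proof.
move=> q0 c0; have [s [s2 A0 BE]] := H4_coef0_eq0 c0.
pose P x := x ^+ 4 - 2 * x ^+ 2 - 2 * s * x + 1.
(* k is the derivative of P at A. *)
pose k := 4 * A ^+ 3 - 4 * A - 2 * s.
have qE x : x != 0 -> x ^+ 2 * H4_coef2 x (s - x^-1) = P x.
  by move=> x0; rewrite /H4_coef2 /P; field: s2.
have PA : P A = 0 by rewrite -qE // -BE q0 mulr0.
have k0 : k != 0.
  apply/eqP => k0.
  (* A double root of [P] is a root of 4P - xP', that is, s/2 or -2s; but [P] takes the values -7/16
     and 13 there. *)
  have : (2 * A - s) * (A + 2 * s) = 0.
    have -> : (2 * A - s) * (A + 2 * s) = (4 * P A - A * k) * (- 2^-1).
      by rewrite /P /k; field: s2.
    by rewrite PA k0 !mulr0 subr0 mul0r.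
  move/eqP; rewrite mulf_eq0 => /orP[] /eqP Ae; move: PA; rewrite /P.
  - have sE : s = 2 * A by lra.
    rewrite sE in s2 *; nra.
  - have AE : A = - 2 * s by lra.
    rewrite AE; nra.
have t0 : (t : R) @[t --> 0^'+] --> (0 : R) by apply: cvg_at_right_filter; exact: cvg_id.
pose f t := A - k * t.
have fA : f t @[t --> 0^'+] --> A.
  rewrite -[X in _ --> X]subr0 -[X in A - X](mulr0 k).
  by apply: cvgB; [exact: cvg_cst|apply: cvgM; [exact: cvg_cst|]].
have gB : s - (f t)^-1 @[t --> 0^'+] --> B.
  by rewrite BE; apply: cvgB; [exact: cvg_cst|exact: cvgV].
apply: (@closed_closure _ (physical_domain R) (A, B)).
apply: (closure_at_right fA gB).
(* Taylor expansion at [A] gives P(A - kt) = P(A) - k^2 t h(t), with h(0) = 1. *)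
pose h t := 1 - t * (6 * A ^+ 2 - 2 - (4 * A * k) * t + k ^+ 2 * (t * t)).
have h1 : h t @[t --> 0^'+] --> h 0.
  apply: cvgB; [exact: cvg_cst|apply: cvgM; first exact: t0].
  apply: cvgD; last by apply: cvgM; [exact: cvg_cst|exact: cvgM].
  by apply: cvgB; [exact: cvg_cst|apply: cvgM; [exact: cvg_cst|exact: t0]].
near=> t.
have ft0 : f t != 0 by near: t; exact: (cvgr_neq0 _ fA).
apply: closure_physical_domain_coef0; last exact: H4_coef0_hyperbola.
have t_gt0 : 0 < t by near: t; exact: nbhs_right_gt.
have ht : 0 < h t by near: t; apply: (cvgr_gt _ h1); rewrite /h mul0r subr0.
have f2 : 0 < f t ^+ 2 by rewrite exprn_even_gt0.
rewrite -(pmulr_rlt0 _ f2) qE //.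
have -> : P (f t) = P A - k ^+ 2 * t * h t by rewrite /P /f /h /k; ring.
by rewrite PA sub0r oppr_lt0 mulr_gt0 // mulr_gt0 // exprn_even_gt0.
Unshelve. all: by end_near.
Qed.

Lemma H4_coef_eq0_ex : exists A B : R, H4_coef2 A B = 0 /\ H4_coef0 A B = 0.
Proof.
(* This is A^2 b on the hyperbola s = 1, negated so that the values -1 at 0 and 2 at 1 have the
   order that [poly_ivt] requires. *)
pose p : {poly R} := - 'X^4 + 2 *: 'X^2 + 2 *: 'X - 1.
have pE x : p.[x] = - (x ^+ 4 - 2 * x ^+ 2 - 2 * x + 1).
  by rewrite /p !hornerE; ring.
have [||x x01 /rootP] := @poly_ivt _ p 0 1; [lra|rewrite !pE; lra|rewrite pE => px].
have x0 : x != 0 by apply: contra_eq_neq px => ->; lra.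
exists x, (1 - x^-1); split; last by rewrite H4_coef0_hyperbola ?expr1n.
apply: (mulfI (expf_neq0 2 x0)); rewrite mulr0.
by transitivity (- - (x ^+ 4 - 2 * x ^+ 2 - 2 * x + 1));
  [rewrite /H4_coef2; field|rewrite px oppr0].
Qed.

End H4.

Theorem lemma4 (R : realType) :
  [/\ physical_domain R !=set0,
      exists p : R * R, EP4 p
    & forall p : R * R, EP4 p -> boundary (physical_domain R) p].
Proof.
split.
(* At the origin b = -3 and c = 1. *)
- by exists (0, 0); apply: physical_domainW; rewrite /H4_coef2 /H4_coef0; nra.
- by have [A [B [q0 c0]]] := @H4_coef_eq0_ex R; exists (A, B); exact: EP4W.
- move=> [A B] /EP4_H4_coef [q0 c0]; split; first exact: closure_physical_domain_nilpotent.
  by move/interior_subset; exact: nilpotent_notin_physical_domain.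
Qed.
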